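(* The following two statements are equivalent: (i) for every positive integer $n$ there exists $k\in\mathbb{N}$ such that $\mathfrak{R}^k(n)=1$; (ii) for every odd positive integer $n$ which is divisible by the square of a prime there exists $k\in\mathbb{N}$ such that $\mathfrak{R}^k(n)=1$.
   Context: $\sigma(n)=\sum_{d\mid n} d$ is the sum-of-divisors function. The map $\mathfrak{R}$ on positive integers is defined by $\mathfrak{R}(n)=\sigma(n)$ if $n$ is odd and $\mathfrak{R}(n)=n/2$ if $n$ is even. Its iterates are $\mathfrak{R}^0(n)=n$ and $\mathfrak{R}^{k+1}(n)=\mathfrak{R}(\mathfrak{R}^k(n))$ for $k\ge 0$. Note that $\mathfrak{R}(1)=1$. *)

(* Defs.v *)
From mathcomp Require Import all_boot.

Set Implicit Arguments.
Unset Strict Implicit.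
Unset Printing Implicit Defensive.

Definition sigma (n : nat) : nat := \sum_(d <- divisors n) d.

(* Only the values at positive arguments are meaningful; [Rmap 0 = 0].
   The iterates are [iter k Rmap n]. *)
Definition Rmap (n : nat) : nat := if odd n then sigma n else n %/ 2.

(* Main.v *)
Require Import Defs.
From mathcomp Require Import all_boot.
From mathcomp Require Import zify.

(** Strong induction on n.  An even n is halved, and an odd n with a square
    factor is covered by (ii).  If n = p_1 ... p_r > 1 is odd and squarefree,
    then sigma(n) is the product of the p_i + 1, so after r halvings it has
    become the product of the (p_i + 1) / 2, which is smaller than n. *)

Lemma sigma_gt0 n : 0 < n -> 0 < sigma n.
Proof.
move=> n_gt0; rewrite /sigma (big_rem n) ?divisors_id //=.
by rewrite addn_gt0 n_gt0.
Qed.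

(** A divisor of [p * m] prime to [p] divides [m] by Gauss; any other is [p * e] with [e] dividing
    [m]. The two lists are disjoint because [p] divides no divisor of [m]. *)
Lemma divisors_primeM p m : prime p -> 0 < m -> ~~ (p %| m) ->
  perm_eq (divisors (p * m)) (divisors m ++ [seq p * d | d <- divisors m]).
Proof.
move=> p_pr m_gt0 pNm; have p_gt0 := prime_gt0 p_pr.
have pm_gt0 : 0 < p * m by rewrite muln_gt0 p_gt0.
have mulpI : injective (muln p) by move=> x y /eqP; rewrite eqn_pmul2l // => /eqP.
apply: uniq_perm; first exact: divisors_uniq.
  rewrite cat_uniq divisors_uniq (map_inj_uniq mulpI) divisors_uniq andbT.
  apply/hasPn=> _ /mapP[d _ ->]; rewrite -dvdn_divisors //.
  by apply: contra pNm; apply: dvdn_trans; apply: dvdn_mulr.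
move=> d; rewrite mem_cat -!dvdn_divisors //.
have [/dvdnP[e ->]|pNd] := boolP (p %| d).
  rewrite mulnC dvdn_pmul2l // mem_map // -dvdn_divisors //.
  have [e_m|_] := boolP (e %| m); first by rewrite orbT.
  rewrite orbF; apply/esym/negP => pe_m.
  by case/negP: pNm; apply: dvdn_trans pe_m; apply: dvdn_mulr.
rewrite Gauss_dvdr; last by rewrite coprime_sym prime_coprime.
rewrite [X in _ || X](_ : _ = false) ?orbF //.
by apply/mapP => -[e _ de]; rewrite de dvdn_mulr in pNd.
Qed.

Lemma sigma_primeM p m : prime p -> 0 < m -> ~~ (p %| m) ->
  sigma (p * m) = p.+1 * sigma m.
Proof.
move=> p_pr m_gt0 pNm.
by rewrite /sigma (perm_big _ (divisors_primeM _ _ p_pr m_gt0 pNm)) big_cat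
  big_map -big_distrr mulSn.
Qed.

(** Induction by splitting off one prime at a time, each adding one to [k]. The weak bound [m <= n]
    is what the induction carries, since the cofactor may be 1, where equality holds. *)
Lemma sigma_odd_squarefree n : 0 < n -> odd n ->
    (forall p, prime p -> ~~ (p ^ 2 %| n)) ->
  exists k m, [/\ sigma n = 2 ^ k * m, m <= n & 1 < n -> m < n].
Proof.
elim/ltn_ind: n => n IHn n_gt0 n_odd n_sqf.
have [n_gt1|n_le1] := ltnP 1 n; last first.
  have -> : n = 1 by lia.
  by exists 0, 1; rewrite /sigma big_seq1.
have p_pr := pdiv_prime n_gt1; have p_gt1 := prime_gt1 p_pr.
have /dvdnP[q def_n] := pdiv_dvd n.
move: (pdiv n) p_pr p_gt1 def_n => p p_pr p_gt1; rewrite mulnC => def_n.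
have q_gt0 : 0 < q by move: n_gt0; rewrite def_n muln_gt0 => /andP[].
have /andP[p_odd q_odd] : odd p && odd q by rewrite -oddM -def_n.
have pNq : ~~ (p %| q).
  by have := n_sqf p p_pr; rewrite def_n expnS dvdn_pmul2l ?prime_gt0.
have q_sqf r : prime r -> ~~ (r ^ 2 %| q).
  move=> r_pr; apply: contra (n_sqf r r_pr) => r2q.
  by rewrite def_n dvdn_mull.
have q_lt_n : q < n by rewrite def_n ltn_Pmull.
have [k [m [sigma_q m_le_q _]]] := IHn q q_lt_n q_gt0 q_odd q_sqf.
(* The new prime alone makes the bound strict: [p.+1./2 < p] as [p > 1]. *)
have m_lt : p.+1./2 * m < n.
  rewrite def_n; apply: (@leq_ltn_trans (p.+1./2 * q)).
    by rewrite leq_mul2l m_le_q orbT.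
  by rewrite ltn_pmul2r //; lia.
exists k.+1, (p.+1./2 * m); split=> //; last exact: ltnW.
rewrite def_n sigma_primeM // sigma_q expnS.
(* Exact because [p] is odd; this 2 is the extra factor in [2 ^ k.+1]. *)
have {1}-> : p.+1 = 2 * p.+1./2 by lia.
by rewrite mulnACA.
Qed.

(** Before each of the [k] steps a factor 2 is left, so every step halves, whatever the parity of
    [m]. *)
Lemma iter_Rmap_exp2M k m : iter k Rmap (2 ^ k * m) = m.
Proof.
elim: k => [|k IHk]; first by rewrite mul1n.
by rewrite iterSr /Rmap expnS -mulnA oddM /= mulKn.
Qed.

Theorem theorem2p6 :
  (forall n : nat, 0 < n -> exists k : nat, iter k Rmap n = 1) <->
  (forall n : nat, 0 < n -> odd n ->
     (exists p : nat, prime p /\ p ^ 2 %| n) ->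
     exists k : nat, iter k Rmap n = 1).
Proof.
split=> [all1 n n_gt0 _ _|sq1 n]; first exact: all1.
elim/ltn_ind: n => n IHn n_gt0.
have [n_gt1|n_le1] := ltnP 1 n; last by exists 0 => /=; lia.
have [n_odd|n_even] := boolP (odd n); last first.
  have [k Rk1] : exists k, iter k Rmap (n %/ 2) = 1 by apply: IHn; lia.
  by exists k.+1; rewrite iterSr {2}/Rmap (negPf n_even).
(* A prime whose square divides [n] is itself a divisor of [n], so a finite boolean search decides
   the case constructively. *)
have [/hasP[p _ /andP[p_pr p2n]]|/hasPn n_sqf] :=
  boolP (has (fun p => prime p && (p ^ 2 %| n)) (divisors n)).
  by apply: sq1 => //; exists p.
have [|k [m [sigma_n _ /(_ n_gt1) m_lt_n]]] := sigma_odd_squarefree n n_gt0 n_odd.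
  move=> p p_pr; apply/negP=> p2n.
  have /n_sqf : p \in divisors n.
    by rewrite -dvdn_divisors //; apply: dvdn_trans p2n; apply: dvdn_exp.
  by rewrite p_pr p2n.
have m_gt0 : 0 < m.
  by move: (sigma_gt0 n n_gt0); rewrite sigma_n muln_gt0 => /andP[].
have [j Rj1] := IHn m m_lt_n m_gt0.
(* One step to [sigma n], [k] halvings down to [m], then [j] steps to 1. *)
by exists (j + k.+1); rewrite iterD iterSr {3}/Rmap n_odd sigma_n iter_Rmap_exp2M.
Qed.
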